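(* Let $G=(V,E,\mu,\kappa)$ be a finite connected undirected graph with at least two vertices, positive vertex masses $\mu$ and positive edge conductances $\kappa$. Let $\lambda_2(G)$ be the Neumann eigenvalue and $\Psi_2(G)$ the Neumann content of $G$. Then $$\frac{\Psi_2}{4}\le\lambda_2\le\Psi_2.$$
   Context: Let $L$ be the Laplacian of $G$ with quadratic form $x^\top Lx=\sum_{(u,v)\in E}\kappa_{(u,v)}(x_u-x_v)^2$ and $M=\mathrm{diag}(\mu)$. The Neumann eigenvalue is $\lambda_2(G)=\min\{\frac{x^\top Lx}{x^\top Mx} : x\in\mathbb{R}^V,\ x^\top M\mathbf{1}=0,\ x\neq 0\}$. For $A\subseteq V$, $\mu(A)=\sum_{v\in A}\mu_v$. For disjoint nonempty $A,B\subseteq V$, the effective resistance $R(A,B)$ is defined by $\frac{1}{R(A,B)}=\min\{x^\top Lx : x|_A=1,\ x|_B=0\}$. The Neumann content is $\Psi_2=\min\{\frac{\mu(A)^{-1}+\mu(B)^{-1}}{R(A,B)} : A,B\subseteq V \text{ nonempty},\ A\cap B=\emptyset\}$. *)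

(* Defs.v *)
From mathcomp Require Import all_boot all_order all_algebra.
From mathcomp Require Import all_classical all_reals all_analysis.
From mathcomp Require Import ring lra.
Set Implicit Arguments.
Unset Strict Implicit.
Unset Printing Implicit Defensive.
Import Order.TTheory GRing.Theory Num.Theory.
Import numFieldNormedType.Exports.
Local Open Scope classical_set_scope.
Local Open Scope ring_scope.

(* The edge set is a symmetric relation; [cond u v] is meaningful only when
   [adj u v].  Loops are not excluded, they contribute 0 to [energy]. *)
Record wgraph (R : realType) := WGraph {
  vertex :> finType;
  adj : rel vertex;
  mass : vertex -> R;
  cond : vertex -> vertex -> R;
  adj_sym : symmetric adj;
  mass_gt0 : forall v, 0 < mass v;
  cond_sym : forall u v, adj u v -> cond u v = cond v u;
  cond_gt0 : forall u v, adj u v -> 0 < cond u v }.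

Arguments adj {R} G : rename.
Arguments mass {R} G : rename.
Arguments cond {R} G : rename.

Definition connected_graph (R : realType) (G : wgraph R) : Prop :=
  forall u v : G, connect (adj G) u v.

Definition is_minimum (R : realType) (S : set R) (m : R) : Prop :=
  S m /\ lbound S m.

(* 0 when [S] has no least element; see [neumann_eigenvalueP],
   [eff_conductanceP] and [neumann_contentP] for the sets used below. *)
Definition minimum (R : realType) (S : set R) : R :=
  xget 0 [set m | is_minimum S m].

Section Definitions.
Variables (R : realType) (G : wgraph R).
Implicit Types (x : {ffun G -> R}) (A B : {set G}).

(* x^T L x.  The sum ranges over ordered pairs, so each undirected edge is
   counted twice, whence the factor 1/2. *)
Definition energy x : R :=
  2^-1 * \sum_(u : G) \sum_(v : G | adj G u v) cond G u v * (x u - x v) ^+ 2.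

Definition laplacian x : {ffun G -> R} :=
  [ffun u : G => \sum_(v : G | adj G u v) cond G u v * (x u - x v)].

(* x^T M y, with M = diag(mass) *)
Definition mass_form x (y : {ffun G -> R}) : R :=
  \sum_(v : G) mass G v * x v * y v.

Definition mass_set A : R := \sum_(v in A) mass G v.

Definition rayleigh_quotients : set R :=
  [set r | exists x, [/\ mass_form x [ffun=> 1] = 0, x != 0 &
                         r = energy x / mass_form x x]].

Definition neumann_eigenvalue : R := minimum rayleigh_quotients.

Definition potential_energies A B : set R :=
  [set r | exists x, [/\ {in A, forall v, x v = 1}, {in B, forall v, x v = 0} &
                         r = energy x]].

Definition eff_conductance A B : R := minimum (potential_energies A B).

Definition eff_resistance A B : R := (eff_conductance A B)^-1.

Definition neumann_quotients : set R :=
  [set r | exists A B, [/\ A != finset.set0, B != finset.set0,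
                         (A :&: B)%SET = finset.set0 &
     r = ((mass_set A)^-1 + (mass_set B)^-1) / eff_resistance A B]].

Definition neumann_content : R := minimum neumann_quotients.

End Definitions.

Lemma minimumP (R : realType) (S : set R) :
  (exists m, is_minimum S m) -> is_minimum S (minimum S).
Proof. by move=> h; exact: (@xgetPex _ 0 [set m | is_minimum S m]). Qed.

Section Facts.
Variables (R : realType) (G : wgraph R).
Implicit Types (x : {ffun G -> R}) (A B : {set G}).

Lemma energy_laplacian x : energy x = \sum_(u : G) x u * laplacian x u.
Proof.
pose c u v := if adj G u v then cond G u v else 0.
have csym u v : c u v = c v u.
  by rewrite /c adj_sym; case: ifP => // /cond_sym ->.
have -> : energy x = 2^-1 * \sum_u \sum_v c u v * (x u - x v) ^+ 2.
  congr (_ * _); apply: eq_bigr => u _; rewrite big_mkcond /=.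
  by apply: eq_bigr => v _; rewrite /c; case: ifP; rewrite ?mul0r.
have -> : \sum_(u : G) x u * laplacian x u
          = \sum_u \sum_v c u v * (x u * (x u - x v)).
  apply: eq_bigr => u _; rewrite ffunE mulr_sumr big_mkcond /=.
  apply: eq_bigr => v _; rewrite /c; case: ifP => _; last by rewrite mul0r.
  by rewrite mulrCA.
set S := RHS.
have S2 : S = \sum_u \sum_v c u v * (x v * (x v - x u)).
  rewrite /S exchange_big /=; apply: eq_bigr => u _; apply: eq_bigr => v _.
  by rewrite csym.
suff -> : \sum_u \sum_v c u v * (x u - x v) ^+ 2 = S + S by lra.
rewrite {2}S2 /S -big_split /=; apply: eq_bigr => u _.
rewrite -big_split /=; apply: eq_bigr => v _; ring.
Qed.

Let ffr (r : 'rV[R]_#|G|) : {ffun G -> R} := [ffun v => r 0 (enum_rank v)].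
Let rff x : 'rV[R]_#|G| := \row_i x (enum_val i).

Let rffK x : ffr (rff x) = x.
Proof. by apply/ffunP => v; rewrite ffunE mxE enum_rankK. Qed.

Let coordC v : continuous (fun r : 'rV[R]_#|G| => ffr r v).
Proof.
have -> : (fun r : 'rV[R]_#|G| => ffr r v) = fun r => r 0 (enum_rank v).
  by apply/funext => r; rewrite ffunE.
exact: coord_continuous.
Qed.

Let sumC (P : pred G) (f : G -> 'rV[R]_#|G| -> R) :
  (forall v, continuous (f v)) -> continuous (fun r => \sum_(v | P v) f v r).
Proof.
move=> fC; apply: (@continuous_big _ _ +%R 0 P) => [|v _]; last exact: fC.
exact: add_continuous.
Qed.

Let mulC (f g : 'rV[R]_#|G| -> R) :
  continuous f -> continuous g -> continuous (fun r => f r * g r).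
Proof. by move=> fC gC r; exact: (continuousM (fC r) (gC r)). Qed.

Let cstC (c : R) : continuous (fun _ : 'rV[R]_#|G| => c).
Proof. exact: cst_continuous. Qed.

Let energyC : continuous (fun r => energy (ffr r)).
Proof.
rewrite /energy; apply: mulC; first exact: cstC.
apply: sumC => u; apply: sumC => v; apply: mulC; first exact: cstC.
have subC : continuous (fun r => ffr r u - ffr r v).
  by move=> r; exact: (continuousB (@coordC u r) (@coordC v r)).
exact: (mulC subC subC).
Qed.

Let box_min (b : R) (P : {ffun G -> R} -> Prop) :
  closed [set r | P (ffr r)] -> (forall x, P x -> forall v, `|x v| <= b) ->
  (exists x, P x) -> exists2 x, P x & forall y, P y -> energy x <= energy y.
Proof.
move=> Pcl Pb [x0 Px0].
have cpt : compact [set r | P (ffr r)].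
  apply: (@subclosed_compact _ _ [set r : 'rV[R]_#|G| | forall i, `[- b, b]%classic (r 0 i)]) => //.
    by apply: (@rV_compact R _ (fun=> `[- b, b]%classic)) => _; exact: segment_compact.
  move=> r /= Pr i; have := Pb _ Pr (enum_val i).
  by rewrite ffunE enum_valK in_itv /= ler_norml.
have [||r Pr rmin] := @EVT_min_rV R _ (fun r => energy (ffr r)) _ _ cpt.
- by exists (rff x0); rewrite /= rffK.
- by apply: continuous_subspaceT; exact: energyC.
exists (ffr r); first by move: Pr; rewrite inE.
by move=> y Py; have := rmin (rff y); rewrite inE /= rffK; apply.
Qed.

Lemma energyZ (a : R) x : energy [ffun v => a * x v] = a ^+ 2 * energy x.
Proof.
rewrite /energy mulrCA; congr (_ * _); rewrite mulr_sumr; apply: eq_bigr => u _.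
rewrite mulr_sumr; apply: eq_bigr => v _; rewrite !ffunE; ring.
Qed.

Lemma mass_formZ (a : R) x :
  mass_form [ffun v => a * x v] [ffun v => a * x v] = a ^+ 2 * mass_form x x.
Proof.
rewrite /mass_form mulr_sumr; apply: eq_bigr => v _; rewrite !ffunE; ring.
Qed.

Lemma mass_formZ1 (a : R) x :
  mass_form [ffun v => a * x v] [ffun=> 1] = a * mass_form x [ffun=> 1].
Proof.
rewrite /mass_form mulr_sumr; apply: eq_bigr => v _; rewrite !ffunE; ring.
Qed.

Lemma mass_form_gt0 x : x != 0 -> 0 < mass_form x x.
Proof.
move=> x0; have [v xv] : exists v, x v != 0.
  apply/existsP; apply: contraNT x0; rewrite negb_exists => /forallP h.
  by apply/eqP/ffunP => v; rewrite ffunE; apply/eqP; rewrite -[_ == _]negbK.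
rewrite /mass_form (bigD1 v) //= ltr_pwDl //.
  by rewrite -mulrA mulr_gt0 ?mass_gt0// -expr2 exprn_even_gt0.
apply: sumr_ge0 => u _.
by rewrite -mulrA -expr2 mulr_ge0 ?sqr_ge0// ltW// mass_gt0.
Qed.

Let closed_eqC (f : 'rV[R]_#|G| -> R) (c : R) :
  continuous f -> closed [set r | f r = c].
Proof.
by move=> fC; apply: (@preimage_closed _ _ f [set c]) => //; exact: closed_eq.
Qed.

Lemma card_gt1_pair : (1 < #|G|)%N -> exists a b : G, a != b.
Proof. by case/card_gt1P => a [b] [_ _ ab]; exists a, b. Qed.

Lemma neumann_eigenvalueP : (1 < #|G|)%N ->
  is_minimum (rayleigh_quotients G) (neumann_eigenvalue G).
Proof.
move=> /card_gt1_pair[a [b ab]]; apply: minimumP.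
pose P x := mass_form x [ffun=> 1] = 0 /\ mass_form x x = 1.
have normP x : x != 0 -> mass_form x [ffun=> 1] = 0 ->
    P [ffun v => (Num.sqrt (mass_form x x))^-1 * x v].
  move=> x0 x1; split; first by rewrite mass_formZ1 x1 mulr0.
  have x_gt0 := mass_form_gt0 x0.
  by rewrite mass_formZ exprVn sqr_sqrtr ?ltW// mulVf// gt_eqF.
have [|||x [x1 xx] xmin] := @box_min (\sum_v (1 + (mass G v)^-1)) P.
- rewrite (_ : mkset _ = [set r | mass_form (ffr r) [ffun=> 1] = 0] `&`
      [set r | mass_form (ffr r) (ffr r) = 1])//.
  apply: closedI; apply: closed_eqC; apply: sumC => v; apply: mulC.
  + by apply: mulC; [exact: cstC|exact: coordC].
  + by rewrite ffunE; exact: cstC.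
  + by apply: mulC; [exact: cstC|exact: coordC].
  + exact: coordC.
- move=> x [_ xx] v; have mv := mass_gt0 v.
  have t_ge0 (u : G) : 0 <= mass G u * x u * x u.
    by rewrite -mulrA -expr2 mulr_ge0 ?sqr_ge0// ltW// mass_gt0.
  have xv : mass G v * x v ^+ 2 <= 1.
    rewrite -xx /mass_form (bigD1 v) //= expr2 mulrA lerDl.
    by apply: sumr_ge0 => u _.
  have xv2 : x v ^+ 2 <= (mass G v)^-1.
    by rewrite -(ler_pM2l mv) divff ?gt_eqF.
  apply: (@le_trans _ _ (1 + (mass G v)^-1)).
    by rewrite ler_norml; apply/andP; split; nra.
  rewrite (bigD1 v) //= lerDl; apply: sumr_ge0 => u _.
  by rewrite addr_ge0// invr_ge0 ltW// mass_gt0.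
- pose x : {ffun G -> R} := [ffun v => if v == a then (mass G a)^-1
     else if v == b then - (mass G b)^-1 else 0].
  exists [ffun v => (Num.sqrt (mass_form x x))^-1 * x v]; apply: normP.
    apply/eqP => /ffunP/(_ a); rewrite !ffunE eqxx => /eqP.
    by rewrite invr_eq0 gt_eqF// mass_gt0.
  rewrite /mass_form (bigD1 a)//= (bigD1 b) 1?eq_sym//= big1 => [|v /andP[va vb]].
    rewrite !ffunE !eqxx eq_sym (negbTE ab) mulrN !divff ?gt_eqF ?mass_gt0//.
    by rewrite !mulr1 addr0 subrr.
  by rewrite !ffunE (negbTE va) (negbTE vb) mulr0 mul0r.
exists (energy x); split.
  exists x; split=> //; last by rewrite xx divr1.
  apply: contra_eq_neq xx => ->; rewrite /mass_form big1 => [|v _].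
    by rewrite eq_sym oner_eq0.
  by rewrite ffunE mulr0.
move=> _ [y [y1 y0 ->]].
have y_gt0 := mass_form_gt0 y0.
have := xmin _ (normP _ y0 y1); rewrite energyZ exprVn sqr_sqrtr; last exact: ltW.
by rewrite mulrC.
Qed.

Let clamp (t : R) := Num.max 0 (Num.min t 1).

Let clamp_contr s t : (clamp s - clamp t) ^+ 2 <= (s - t) ^+ 2.
Proof.
wlog ts : s t / t <= s => [h|].
  have [|/ltW] := leP t s; first exact: h.
  by move=> /h; rewrite -sqrrN opprB -[leRHS]sqrrN opprB.
have [h0 h1] : 0 <= clamp s - clamp t /\ clamp s - clamp t <= s - t.
  rewrite /clamp !maxEle !minEle.
  by case: (leP s 1) => ?; case: (leP t 1) => ?; rewrite ?ler01;
    case: (leP 0 s) => ?; case: (leP 0 t) => ?; split; lra.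
by rewrite ler_pXn2r// nnegrE ?subr_ge0.
Qed.

Lemma eff_conductanceP A B : (A :&: B)%SET = finset.set0 ->
  is_minimum (potential_energies A B) (eff_conductance A B).
Proof.
move=> AB; apply: minimumP.
pose P x := (forall v, v \in A -> x v = 1) /\ (forall v, v \in B -> x v = 0) /\
  (forall v, 0 <= x v <= 1).
have [|||x [xA [xB x01]] xmin] := @box_min 1 P.
- rewrite (_ : mkset _ = \bigcap_(v in [set v | v \in A]) [set r | ffr r v = 1]
    `&` (\bigcap_(v in [set v | v \in B]) [set r | ffr r v = 0]
    `&` \bigcap_(v in setT) [set r | ffr r v \in `[0, 1]])); last first.
    apply/seteqP; split=> r /=.
      by move=> [rA [rB r01]]; split=> [//|]; split=> // v _ /=; rewrite in_itv/=.
    move=> [rA [rB r01]]; split=> [//|]; split=> // v.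
    by have := r01 v I; rewrite /= in_itv.
  apply: closedI; first by apply: closed_bigI => v _; exact: closed_eqC.
  apply: closedI; first by apply: closed_bigI => v _; exact: closed_eqC.
  apply: closed_bigI => v _.
  apply: (@preimage_closed _ _ (fun r => ffr r v) `[0, 1]%classic) => //.
  exact: itv_closed.
- by move=> x [_ [_ x01]] v; have /andP[x0 x1] := x01 v; rewrite ger0_norm.
- exists [ffun v => (v \in A)%:R]; split; [|split] => v.
  + by rewrite ffunE => ->.
  + move=> vB; rewrite ffunE; case: (boolP (v \in A)) => // vA.
    by have := finset.in_setI v A B; rewrite AB finset.inE vA vB.
  + by rewrite ffunE; case: (v \in A); rewrite ?lexx ?ler01.
exists (energy x); split; first by exists x.
move=> _ [y [yA yB ->]].
apply: (@le_trans _ _ (energy [ffun v => clamp (y v)])).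
  apply: xmin; split; [|split] => v.
  + by move=> /yA yv; rewrite ffunE yv /clamp minxx maxEle ler01.
  + by move=> /yB yv; rewrite ffunE yv /clamp minEle ler01 maxxx.
  + by rewrite ffunE /clamp le_max lexx /= ge_max ler01 ge_min lexx orbT.
rewrite /energy ler_pM2l ?invr_gt0//; apply: ler_sum => u _.
by apply: ler_sum => v uv; rewrite !ffunE ler_pM2l ?cond_gt0.
Qed.

Lemma neumann_contentP : (1 < #|G|)%N ->
  is_minimum (neumann_quotients G) (neumann_content G).
Proof.
move=> /card_gt1_pair[a [b ab]]; apply: minimumP.
pose Q (p : {set G} * {set G}) := [&& p.1 != finset.set0, p.2 != finset.set0 &
  (p.1 :&: p.2)%SET == finset.set0].
pose f (p : {set G} * {set G}) :=
  ((mass_set p.1)^-1 + (mass_set p.2)^-1) / eff_resistance p.1 p.2.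
have Q0 : Q ([set a]%SET, [set b]%SET).
  rewrite /Q /=; apply/and3P; split.
  - by apply/finset.set0Pn; exists a; rewrite finset.inE.
  - by apply/finset.set0Pn; exists b; rewrite finset.inE.
  - apply/eqP/setP => v; rewrite !finset.inE; apply/negP => /andP[/eqP-> /eqP abE].
    by rewrite abE eqxx in ab.
case: (arg_minP f Q0) => -[A B] /and3P[/= A0 B0 /eqP AB] minf.
exists (f (A, B)); split; first by exists A, B.
move=> _ [A' [B' [A'0 B'0 AB' ->]]].
by apply: (minf (A', B')); rewrite /Q /= A'0 B'0 AB' eqxx.
Qed.

End Facts.

(* Main.v *)
(** Upper bound: center the potential that realizes the effective conductance
    of an optimal pair (A, B); its variance is at least
    mu(A) mu(B) / (mu(A) + mu(B)).

    Lower bound: let x be an eigenvector and sort the vertices by x.  The cut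
    between two consecutive values has a flux F_i, and composing x with a
    suitable function shows that the series resistance P(a, b), the sum of the
    gap_i / F_i between a and b, is at most R({x >= b}, {x <= a}).  Hence
    Psi_2 P(a, b) <= 1 / mu(x >= b) + 1 / mu(x <= a).  Since P is additive, this
    separates: some threshold c satisfies both Psi_2 P(c, b) <= 1 / mu(x >= b)
    for b above c and Psi_2 P(a, c) <= 1 / mu(x <= a) for a below c.  Hardy's
    inequality with constant 4 on each side of c bounds
    Psi_2 sum mu (x - c)^2 by 4 x^T L x, and x has mean zero. *)

Require Import Defs.
From mathcomp Require Import all_boot all_order all_algebra.
From mathcomp Require Import all_classical all_reals all_analysis.
From mathcomp Require Import ring lra zify.
Set Implicit Arguments.
Unset Strict Implicit.
Unset Printing Implicit Defensive.
Import Order.TTheory GRing.Theory Num.Theory.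
Local Open Scope ring_scope.

(** * Elementary inequalities and the discrete Hardy inequality *)

(** The weighted sum of the squares (r_i - t)^2 is nonnegative for every t; the choice t = T / S
    gives the bound. *)
Lemma weighted_cauchy_schwarz (R : realFieldType) (I : finType) (c r : I -> R) :
  (forall i, 0 <= c i) ->
  (\sum_i c i * r i) ^+ 2 <= (\sum_i c i * r i ^+ 2) * \sum_i c i.
Proof.
move=> c_ge0; set T := \sum_i c i * r i; set Q := \sum_i _; set S := \sum_i c i.
have key t : 0 <= Q - 2 * t * T + t ^+ 2 * S.
  have -> : Q - 2 * t * T + t ^+ 2 * S = \sum_i c i * (r i - t) ^+ 2.
    rewrite /Q /T /S !mulr_sumr -sumrN -!big_split /=.
    by apply: eq_bigr => i _; ring.
  by apply: sumr_ge0 => i _; rewrite mulr_ge0 ?sqr_ge0.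
have S_ge0 : 0 <= S by apply: sumr_ge0.
have [S0|S0] := eqVneq S 0.
  have c0 i : c i = 0.
    by move/eqP: S0; rewrite psumr_eq0// => /allP/(_ i (mem_index_enum i))/eqP.
  by rewrite /T S0 mulr0 big1 ?expr0n// => i _; rewrite c0 mul0r.
have S_gt0 : 0 < S by rewrite lt_def S0.
have := mulr_ge0 S_ge0 (key (T / S)).
rewrite (_ : S * _ = Q * S - T ^+ 2) ?subr_ge0//.
by field.
Qed.

Lemma sum_increments (R : zmodType) (y : nat -> R) (n k : nat) : (k <= n)%N ->
  \sum_(i < n | (i < k)%N) (y i.+1 - y i) = y k - y 0%N.
Proof.
move=> kn; rewrite -(big_ord_widen n (fun i => y i.+1 - y i) kn).
by rewrite -(big_mkord xpredT (fun i => y i.+1 - y i)) telescope_sumr.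
Qed.

(* One step of the discrete Hardy inequality: integrated form of
   (2 h' - h / s)^2 >= 0, with h^2 / s as the telescoping potential. *)
Lemma hardy_step (R : realFieldType) (s s' h h' f M : R) :
  0 <= s -> s <= s' -> 0 <= h -> (s = 0 -> h = 0) -> 0 <= f -> M * s' <= 1 ->
  h' = h + f * (s' - s) ->
  M * (h' ^+ 2 - h ^+ 2) + h' ^+ 2 / s' <= 4 * (f * (h' - h)) + h ^+ 2 / s.
Proof.
move=> s0 ss' h0 sh f0 Ms' h'E.
have [s'0|s'0] := eqVneq s' 0.
  have e : s = 0 by lra.
  by rewrite h'E s'0 e (sh e) !subrr mulr0 addr0 expr0n /= subrr !mulr0 mul0r addr0.
have s'_gt0 : 0 < s' by rewrite lt_def s'0 (le_trans s0).
have hh' : 0 <= h' ^+ 2 - h ^+ 2.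
  have : 0 <= f * (s' - s) by rewrite mulr_ge0// subr_ge0.
  rewrite h'E; nra.
have M1 : M <= s'^-1 by rewrite -[leRHS]mul1r ler_pdivlMr.
(* Since h'^2 - h^2 is nonnegative, [M] may be replaced by its largest admissible value 1 / s'. *)
apply: (@le_trans _ _ (s'^-1 * (h' ^+ 2 - h ^+ 2) + h' ^+ 2 / s')).
  by rewrite lerD2r ler_wpM2r.
(* For s = 0 also h = 0, and [h ^+ 2 / s] is 0 by the convention for division. *)
have [e|s_neq0] := eqVneq s 0.
  rewrite h'E e (sh e) !subr0 !add0r expr0n /= mul0r subr0 addr0.
  have -> : s'^-1 * (f * s') ^+ 2 + (f * s') ^+ 2 / s' = 2 * (f * (f * s')).
    by field.
  have : 0 <= f * (f * s') by rewrite !mulr_ge0// ltW.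
  lra.
have s_gt0 : 0 < s by rewrite lt_def s_neq0.
rewrite -subr_ge0.
have -> : 4 * (f * (h' - h)) + h ^+ 2 / s -
    (s'^-1 * (h' ^+ 2 - h ^+ 2) + h' ^+ 2 / s') =
    (s' - s) / (s * s') * ((h - 2 * s * f) ^+ 2 + 2 * s * (s' - s) * f ^+ 2).
  by rewrite h'E; field; rewrite s_neq0 s'0.
rewrite mulr_ge0 ?divr_ge0 ?mulr_ge0 ?subr_ge0 ?(ltW s_gt0) ?(ltW s'_gt0)//.
by rewrite addr_ge0 ?sqr_ge0// !mulr_ge0 ?sqr_ge0 ?subr_ge0.
Qed.

(** Induction from the left end: [hardy_step] trades the boundary terms at index 1 (tail mass and 1
    / s, both times h^2) for those at index 0. Allowing a nonzero [h 0] is what lets the induction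
    pass to the shifted sequences. *)
Lemma discrete_hardy (R : realFieldType) (N : nat) (m h s f : nat -> R) :
  0 <= s 0%N -> 0 <= h 0%N -> (s 0%N = 0 -> h 0%N = 0) ->
  (forall i, (i < N)%N -> s i <= s i.+1) ->
  (forall i, (i < N)%N -> 0 <= f i) ->
  (forall i, (i < N)%N -> h i.+1 = h i + f i * (s i.+1 - s i)) ->
  (forall i, (i <= N)%N -> (\sum_(i <= j < N.+1) m j) * s i <= 1) ->
  \sum_(0 <= i < N.+1) m i * h i ^+ 2 <=
  (\sum_(0 <= i < N.+1) m i) * h 0%N ^+ 2 + h 0%N ^+ 2 / s 0%N +
  4 * \sum_(0 <= i < N) f i * (h i.+1 - h i).
Proof.
elim: N m h s f => [|N IH] m h s f s0 h0 sh sN fN hN mN.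
  rewrite !big_nat1 big_geq// mulr0 addr0 lerDl.
  by rewrite divr_ge0 ?sqr_ge0.
have := IH (m \o S) (h \o S) (s \o S) (f \o S).
have step := @hardy_step _ (s 0%N) (s 1%N) (h 0%N) (h 1%N) (f 0%N)
  (\sum_(1 <= j < N.+2) m j) s0 (sN 0%N isT) h0 sh (fN 0%N isT) (mN 1%N isT)
  (hN 0%N isT).
have f0 := fN 0%N isT; have s1 := sN 0%N isT; have h1 := hN 0%N isT.
have fs : 0 <= f 0%N * (s 1%N - s 0%N) by rewrite mulr_ge0// subr_ge0.
have IHs : 0 <= s 1%N by lra.
have IHh : 0 <= h 1%N by lra.
have IHsh : s 1%N = 0 -> h 1%N = 0.
  move=> e; have e0 : s 0%N = 0 by lra.
  by rewrite h1 e e0 subrr mulr0 addr0 sh.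
move=> /(_ IHs IHh IHsh) /=.
move=> /(_ (fun i iN => sN i.+1 iN) (fun i iN => fN i.+1 iN)
  (fun i iN => hN i.+1 iN)).
have mS i : (i <= N)%N -> (\sum_(i <= j < N.+1) m j.+1) * s i.+1 <= 1.
  by move=> iN; have := mN i.+1 iN; rewrite big_add1.
move=> /(_ mS).
rewrite big_add1 /= in step.
rewrite (big_nat_recl N.+1)//= (big_nat_recl N.+1)//= (big_nat_recl N 0%N (fun i => f i * _))//=.
lra.
Qed.

(** * A Poincare inequality on a weighted path *)

(** The last two conditions bound p below by all P b - 1 / U b and above by all P a + 1 / L a. Each
    lower bound is at most each upper one: by the last hypothesis if a < b, by monotonicity of [P]
    otherwise. So p is taken as the largest lower bound, or P 0 if that is larger. *)
Lemma balanced_threshold (R : realFieldType) (n : nat) (P L U : nat -> R) :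
  (forall i, (i < n)%N -> P i <= P i.+1) -> P 0%N < P n ->
  (forall i, (i <= n)%N -> 0 < U i) -> (forall i, (i <= n)%N -> 0 < L i) ->
  (forall a b, (a < b <= n)%N -> P b - P a <= (U b)^-1 + (L a)^-1) ->
  exists p, [/\ P 0%N <= p, p < P n,
    forall b, (b <= n)%N -> U b * (P b - p) <= 1 &
    forall a, (a <= n)%N -> L a * (p - P a) <= 1].
Proof.
move=> Pmono P0n U_gt0 L_gt0 PUL.
have Pmon a b : (a <= b)%N -> (b <= n)%N -> P a <= P b.
  elim: b => [|b IH]; first by rewrite leqn0 => /eqP->.
  rewrite leq_eqVlt => /orP[/eqP->//|ab] bn.
  by apply: le_trans (IH ab (ltnW bn)) _; exact: Pmono.
pose p := \big[Num.max/P 0%N]_(b < n.+1) (P b - (U b)^-1).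
exists p; split.
- exact: bigmax_ge_id.
- apply: bigmax_lt => // b _.
  have bn : (b <= n)%N by rewrite -ltnS.
  have : 0 < (U b)^-1 by rewrite invr_gt0 U_gt0.
  by have := Pmon b n bn (leqnn n); lra.
- move=> b bn; rewrite -ler_pdivlMl ?U_gt0// mulr1.
  have : P b - (U b)^-1 <= p.
    exact: (le_bigmax _ (fun b : 'I_n.+1 => P b - (U b)^-1) (Ordinal (bn : (b < n.+1)%N))).
  lra.
- move=> a an; rewrite -ler_pdivlMl ?L_gt0// mulr1.
  have La : 0 < (L a)^-1 by rewrite invr_gt0 L_gt0.
  suff : p <= P a + (L a)^-1 by lra.
  apply: bigmax_le => [|b _]; first by have := Pmon 0%N a (leq0n a) an; lra.
  have bn : (b <= n)%N by rewrite -ltnS.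
  have [ab|ba] := ltnP a b; first by have := PUL a b; rewrite ab bn => /(_ isT); lra.
  have := Pmon b a ba an.
  have : 0 < (U b)^-1 by rewrite invr_gt0 U_gt0.
  lra.
Qed.

(** [P] is a coordinate along the path in which [y] has slope [f]; Hardy's inequality is run outward
    from the balanced point p in both directions. *)
Lemma path_poincare (R : realFieldType) (n : nat) (m y P f : nat -> R) :
  (forall i, (i <= n)%N -> 0 < m i) ->
  (forall i, (i < n)%N -> 0 <= f i) ->
  (forall i, (i < n)%N -> P i <= P i.+1) -> P 0%N < P n ->
  (forall i, (i < n)%N -> y i.+1 - y i = f i * (P i.+1 - P i)) ->
  (forall a b, (a < b <= n)%N -> P b - P a <=
     (\sum_(b <= i < n.+1) m i)^-1 + (\sum_(0 <= i < a.+1) m i)^-1) ->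
  exists c, \sum_(0 <= i < n.+1) m i * (y i - c) ^+ 2 <=
    4 * \sum_(0 <= i < n) f i * (y i.+1 - y i).
Proof.
move=> m_gt0 f_ge0 Pmono P0n yP PUL.
have [b bn|a an|p [P0p pPn pU pL]] := @balanced_threshold R n P
   (fun a => \sum_(0 <= i < a.+1) m i) (fun b => \sum_(b <= i < n.+1) m i) Pmono P0n _ _ PUL.
- rewrite big_nat_recr//= ltr_pwDr ?m_gt0// big_nat_cond.
  apply: sumr_ge0 => i; rewrite andbT => /andP[_ ib]; rewrite ltW ?m_gt0//; lia.
- rewrite big_nat_recr//= ltr_pwDr ?m_gt0// big_nat_cond.
  apply: sumr_ge0 => i; rewrite andbT => /andP[_ ib]; rewrite ltW ?m_gt0//; lia.
have exk : exists i, (i <= n)%N && (p < P i) by exists n; rewrite leqnn.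
case: (ex_minnP exk) => -[|k] /andP[kn pPk] kmin; first by rewrite ltNge P0p in pPk.
have Pkp : P k <= p.
  by rewrite leNgt; apply/negP => pk; have := kmin k; rewrite pk (ltnW kn) ltnn => /(_ isT).
(* Here P k <= p < P k.+1, and c is the value at p of [y] interpolated linearly in [P]. The step
   from k to k.+1 thus splits into two parts of slope [f k], one for each side. *)
pose c := y k + f k * (p - P k); exists c.
have fk := f_ge0 _ kn.
have yk := yP _ kn.
have hk : y k.+1 - c = f k * (P k.+1 - p).
  by rewrite /c -[y k.+1](subrK (y k)) yk; ring.
(* The partial step from p to the nearest vertex: Hardy from s = h = 0 absorbs the boundary terms of
   [discrete_hardy]. *)
have start s h g M : 0 <= s -> 0 <= g -> M * s <= 1 -> h = g * s ->
    M * h ^+ 2 + h ^+ 2 / s <= 4 * (g * h) :> R.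
  move=> s0 g0 Ms hE; have := @hardy_step R 0 s 0 h g M (lexx _) s0 (lexx _)
    (fun _ => erefl) g0 Ms.
  by rewrite expr0n /= mul0r !subr0 add0r addr0; apply.
have right : \sum_(k.+1 <= i < n.+1) m i * (y i - c) ^+ 2 <=
    4 * (f k * (y k.+1 - c)) + 4 * \sum_(k.+1 <= i < n) f i * (y i.+1 - y i).
  rewrite -[k.+1]add0n !big_addn subSn// add0n.
  apply: le_trans (@discrete_hardy R (n - k.+1) (fun i => m (i + k.+1)%N)
    (fun i => y (i + k.+1)%N - c) (fun i => P (i + k.+1)%N - p)
    (fun i => f (i + k.+1)%N) _ _ _ _ _ _ _) _; rewrite ?add0n.
  - by rewrite subr_ge0 ltW.
  - by rewrite hk mulr_ge0// subr_ge0 ltW.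
  - by move=> e; move: pPk; rewrite -subr_gt0 e ltxx.
  - by move=> i ik; rewrite lerD2r addSn Pmono//; lia.
  - by move=> i ik; rewrite f_ge0//; lia.
  - move=> i ik; have -> : (i.+1 + k.+1 = (i + k.+1).+1)%N by [].
    have ik' : (i + k.+1 < n)%N by lia.
    by have := yP _ ik'; lra.
  - move=> i ik; have := pU (i + k.+1)%N; rewrite big_addn subSn; last lia.
    by apply; lia.
  apply: lerD; last first.
    rewrite ler_pM2l// le_eqVlt; apply/orP; left; apply/eqP.
    by apply: eq_bigr => i _; rewrite addSn; ring.
  apply: start => //; first by rewrite subr_ge0 ltW.
  by have := pU k.+1 kn; rewrite -{1}[k.+1]add0n big_addn subSn.
have left : \sum_(0 <= i < k.+1) m i * (y i - c) ^+ 2 <=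
    4 * (f k * (c - y k)) + 4 * \sum_(0 <= i < k) f i * (y i.+1 - y i).
  rewrite big_nat_rev [in leRHS]big_nat_rev /= add0n.
  have ck : c - y k = f k * (p - P k) by rewrite /c; ring.
  under eq_bigr do rewrite subSS -sqrrN opprB.
  (* The left side is traversed backwards; its step i joins k - i to k - i.+1, hence the slope
     [f (k - i.+1)]. *)
  apply: le_trans (@discrete_hardy R k (fun i => m (k - i)%N)
    (fun i => c - y (k - i)%N) (fun i => p - P (k - i)%N)
    (fun i => f (k - i.+1)%N) _ _ _ _ _ _ _) _; rewrite ?subn0.
  - by rewrite subr_ge0.
  - by rewrite ck mulr_ge0 ?subr_ge0.
  - by rewrite ck => ->; rewrite mulr0.
  - move=> i ik; have ik' : (k - i.+1 < n)%N by lia.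
    by have := Pmono _ ik'; rewrite -subSn// subSS; lra.
  - by move=> i ik; rewrite f_ge0//; lia.
  - move=> i ik; have ik' : (k - i.+1 < n)%N by lia.
    by have := yP _ ik'; rewrite -subSn// subSS; lra.
  - move=> i ik; have ik' : (k - i <= n)%N by lia.
    rewrite (_ : \sum_(i <= j < k.+1) _ = \sum_(0 <= j < (k - i).+1) m j) ?pL//.
    rewrite big_nat_rev -{1}[i]add0n big_addn subSn//.
    by apply: eq_big_nat => j jk; congr m; lia.
  apply: lerD; last first.
    rewrite ler_pM2l// le_eqVlt; apply/orP; left; apply/eqP.
    by apply: eq_big_nat => i /andP[_ ik]; rewrite -subSn// subSS; ring.
  apply: start; rewrite ?subr_ge0//.
  have := pL k (ltnW kn); rewrite big_nat_rev /= add0n.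
  by under eq_bigr do rewrite subSS.
rewrite (big_cat_nat (n := k.+1))//= ?leqW//.
rewrite [in leRHS](big_cat_nat (n := k))//= ?(ltnW kn)// [in leRHS](big_ltn kn).
lra.
Qed.

(** * Cut edges and enumeration by rank *)

(** Take the first edge of a connecting path that leaves [a]. This is how connectedness will force
    positive flux through a cut. *)
Lemma connect_cut_edge (T : finType) (e : rel T) (a : pred T) (u v : T) :
  connect e u v -> a u -> ~~ a v -> exists u' v', [/\ e u' v', a u' & ~~ a v'].
Proof.
case/connectP => p; elim: p u => [|w p IH] u /= => [_ -> -> //|].
case/andP => uw pw vE au av; have [aw|aw] := boolP (a w); first exact: IH pw vE aw av.
by exists u, w.
Qed.

(** Ranks break ties, so the level cuts become initial segments of ranks; [e] takes a default value
    from [#|T|] on. *)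
Lemma sorted_enumeration (R : realDomainType) (T : finType) (x : T -> R) :
  (0 < #|T|)%N -> exists (e : nat -> T) (rk : T -> nat),
  [/\ forall v, (rk v < #|T|)%N, cancel rk e,
      forall i, (i < #|T|)%N -> rk (e i) = i &
      forall u v, (rk u <= rk v)%N -> x u <= x v].
Proof.
case/card_gt0P => v0 _.
pose s := sort (relpre x <=%R) (enum T).
have sz : size s = #|T| by rewrite size_sort cardE.
have mems v : v \in s by rewrite mem_sort mem_enum.
exists (nth v0 s), (index^~ s); split.
- by move=> v; rewrite -sz index_mem.
- by move=> v; rewrite nth_index.
- by move=> i iT; rewrite index_uniq ?sz// sort_uniq enum_uniq.
move=> u v uv.
have sorted_s : sorted (relpre x <=%R) s.
  by apply: sort_sorted => a b; exact: le_total.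
have le_x_trans : transitive (relpre x <=%R) by move=> a b c; exact: le_trans.
have := sorted_leq_nth le_x_trans (fun a => lexx (x a)) v0 sorted_s.
move=> /(_ (index u s) (index v s)).
by rewrite !inE !index_mem !mems !nth_index//=; apply.
Qed.

Lemma sum_enumeration (V : nmodType) (T : finType) (e : nat -> T) (rk : T -> nat)
    (Q : pred nat) (F : T -> V) :
  (forall v, (rk v < #|T|)%N) -> cancel rk e ->
  (forall i, (i < #|T|)%N -> rk (e i) = i) ->
  \sum_(v | Q (rk v)) F v = \sum_(0 <= i < #|T| | Q i) F (e i).
Proof.
move=> rkT rkK eK; rewrite big_mkord.
rewrite (reindex_onto (fun j : 'I_#|T| => e j) (fun v => Ordinal (rkT v))) /=; last first.
  by move=> v _; rewrite rkK.
apply: eq_bigl => j; rewrite [X in _ && X](_ : _ = true) ?andbT ?eK//.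
by apply/eqP/val_inj; rewrite /= eK.
Qed.

(** * The energy as a bilinear form *)

Section EnergyForm.
Variables (R : realType) (G : wgraph R).
Implicit Types x z w : G -> R.

(** Polarization x^T L z of [energy], on plain functions so that indicators of cuts can be inserted
    directly. *)
Definition energy_form x z : R :=
  2^-1 * \sum_(u : G) \sum_(v : G | adj G u v)
     cond G u v * ((x u - x v) * (z u - z v)).

Lemma energyE (x : {ffun G -> R}) : energy x = energy_form x x.
Proof. by []. Qed.

Lemma energy_shift (c : R) (x : {ffun G -> R}) :
  energy [ffun v => x v - c] = energy x.
Proof.
congr (_ * _); apply: eq_bigr => u _; apply: eq_bigr => v _.
by rewrite !ffunE; congr (_ * _ ^+ 2); ring.
Qed.

Lemma le_energy_form x z x' z' :
  (forall u v, (x u - x v) * (z u - z v) <= (x' u - x' v) * (z' u - z' v)) ->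
  energy_form x z <= energy_form x' z'.
Proof.
move=> h; rewrite ler_pM2l ?invr_gt0//; apply: ler_sum => u _.
by apply: ler_sum => v uv; rewrite ler_pM2l ?cond_gt0.
Qed.

Lemma energy_form_ge0 x z :
  (forall u v, 0 <= (x u - x v) * (z u - z v)) -> 0 <= energy_form x z.
Proof.
move=> h; rewrite mulr_ge0 ?invr_ge0//; apply: sumr_ge0 => u _.
by apply: sumr_ge0 => v uv; rewrite mulr_ge0// ltW// cond_gt0.
Qed.

Lemma energy_ge0 (x : {ffun G -> R}) : 0 <= energy x.
Proof. by rewrite energyE energy_form_ge0// => u v; rewrite -expr2 sqr_ge0. Qed.

Lemma energy_form_gt0 x z (u v : G) :
  (forall u v, 0 <= (x u - x v) * (z u - z v)) ->
  adj G u v -> 0 < (x u - x v) * (z u - z v) -> 0 < energy_form x z.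
Proof.
move=> h uv xz; rewrite mulr_gt0 ?invr_gt0// (bigD1 u)//= (bigD1 v)//=.
rewrite -addrA ltr_pwDl//; first by apply: mulr_gt0; rewrite ?cond_gt0.
apply: addr_ge0.
  by apply: sumr_ge0 => w /andP[uw _]; rewrite mulr_ge0// ltW// cond_gt0.
apply: sumr_ge0 => w _; apply: sumr_ge0 => w' ww'.
by rewrite mulr_ge0// ltW// cond_gt0.
Qed.

Lemma energy_form_sumr (I : finType) (a : I -> R) (z : I -> G -> R) x w (c : R) :
  (forall v, w v = c + \sum_i a i * z i v) ->
  energy_form x w = \sum_i a i * energy_form x (z i).
Proof.
move=> wE; rewrite /energy_form.
under [RHS]eq_bigr do rewrite mulrCA mulr_sumr.
rewrite -mulr_sumr exchange_big /=; congr (_ * _); apply: eq_bigr => u _.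
under [RHS]eq_bigr do rewrite mulr_sumr.
rewrite exchange_big /=; apply: eq_bigr => v _.
have -> : w u - w v = \sum_i a i * (z i u - z i v).
  rewrite !wE opprD addrACA subrr add0r -sumrB; apply: eq_bigr => i _; ring.
by rewrite !mulr_sumr; apply: eq_bigr => i _; ring.
Qed.

Lemma mass_form1 (x : {ffun G -> R}) :
  mass_form x [ffun=> 1] = \sum_v mass G v * x v.
Proof. by apply: eq_bigr => v _; rewrite ffunE mulr1. Qed.

Lemma mass_formE (x : {ffun G -> R}) :
  mass_form x x = \sum_v mass G v * x v ^+ 2.
Proof. by apply: eq_bigr => v _; rewrite -mulrA -expr2. Qed.

Lemma mass_set_gt0 (A : {set G}) : A != finset.set0 -> 0 < mass_set A.
Proof.
case/finset.set0Pn => a aA; rewrite /mass_set (bigD1 a)//= ltr_pwDl ?mass_gt0//.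
by apply: sumr_ge0 => v _; rewrite ltW ?mass_gt0.
Qed.

End EnergyForm.

(** * Layers, flux and series resistance *)

Section Layers.
Variables (R : realType) (G : wgraph R) (rk : G -> nat) (n : nat).
Variables (x : {ffun G -> R}) (y : nat -> R).
Hypothesis y_rk : forall v, y (rk v) = x v.
Hypothesis rk_le : forall v, (rk v <= n)%N.
Hypothesis y_mono : forall i, (i < n)%N -> y i <= y i.+1.

Definition layer (i : nat) (v : G) : R := (i < rk v)%N%:R.

(* Net flow of the gradient of [x] across the cut between the vertices of rank
   at most [i] and the others. *)
Definition flux (i : nat) : R := energy_form x (layer i).

(** A discrete layer-cake formula: exactly the increments below [rk v] are switched on, and they
    telescope. *)
Lemma rank_function_layers (g : nat -> R) (v : G) :
  g (rk v) = g 0%N + \sum_(i < n) (g i.+1 - g i) * layer i v.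
Proof.
rewrite -[LHS](subrK (g 0%N)) addrC -(sum_increments g (rk_le v)) big_mkcond.
by congr (_ + _); apply: eq_bigr => i _; rewrite /layer; case: ifP;
  rewrite ?mulr1 ?mulr0.
Qed.

Lemma y_homo i j : (i <= j <= n)%N -> y i <= y j.
Proof.
elim: j => [|j IH]; first by rewrite leqn0 => /andP[/eqP->].
rewrite leq_eqVlt => /andP[/orP[/eqP->//|ij] jn].
by apply: le_trans (IH _) (y_mono _); rewrite // -ltnS ij ltnW.
Qed.

Lemma layer_homo i u v : (rk u <= rk v)%N -> layer i u <= layer i v.
Proof.
move=> uv; rewrite /layer ler_nat.
by case: (ltnP i (rk u)) => // iu; rewrite (leq_trans iu uv).
Qed.

Lemma flux_term_ge0 i u v : 0 <= (x u - x v) * (layer i u - layer i v).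
Proof.
wlog uv : u v / (rk v <= rk u)%N => [h|].
  have [|/ltnW] := leqP (rk v) (rk u); first exact: h.
  by move/h; rewrite -mulrNN !opprB.
rewrite mulr_ge0 ?subr_ge0 ?layer_homo// -!y_rk.
by rewrite y_homo// uv rk_le.
Qed.

Lemma flux_ge0 i : 0 <= flux i.
Proof. by apply: energy_form_ge0 => u v; exact: flux_term_ge0. Qed.

(** A coarea formula, from expanding the second argument of [energy_form x x] in layers. *)
Lemma energy_flux : energy x = \sum_(i < n) flux i * (y i.+1 - y i).
Proof.
rewrite energyE (@energy_form_sumr _ _ _ (fun i : 'I_n => y i.+1 - y i)
  (fun i : 'I_n => layer i) _ _ (y 0%N)).
  by apply: eq_bigr => i _; rewrite mulrC.
by move=> v; rewrite -rank_function_layers y_rk.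
Qed.

(** On each edge, Cauchy-Schwarz weighted by the increments of [y] bounds the squared difference of
    [g] by the difference of [x] times that of the layered function [w]. Summing over edges leaves
    [energy_form x w], which expands into fluxes. *)
Lemma energy_reparametrize_le (g r : nat -> R) :
  (forall i, (i < n)%N -> g i.+1 - g i = (y i.+1 - y i) * r i) ->
  energy [ffun v => g (rk v)] <= \sum_(i < n) (y i.+1 - y i) * r i ^+ 2 * flux i.
Proof.
move=> gr.
pose w v := \sum_(i < n) (y i.+1 - y i) * r i ^+ 2 * layer i v.
rewrite -(@energy_form_sumr _ _ _ (fun i : 'I_n => (y i.+1 - y i) * r i ^+ 2)
  (fun i : 'I_n => layer i) x w 0); last by move=> v; rewrite add0r.
rewrite energyE; apply: le_energy_form => u v; rewrite !ffunE -expr2.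
wlog uv : u v / (rk v <= rk u)%N => [h|].
  have [|/ltnW] := leqP (rk v) (rk u); first exact: h.
  by move/h; rewrite -mulrNN !opprB -sqrrN opprB.
rewrite -!y_rk !(rank_function_layers y) !(rank_function_layers g).
pose c (i : 'I_n) := (y i.+1 - y i) * (layer i u - layer i v).
have -> : g 0%N + \sum_(i < n) (g i.+1 - g i) * layer i u -
    (g 0%N + \sum_(i < n) (g i.+1 - g i) * layer i v) = \sum_i c i * r i.
  rewrite opprD addrACA subrr add0r -sumrB; apply: eq_bigr => i _.
  by rewrite gr// /c; ring.
have -> : y 0%N + \sum_(i < n) (y i.+1 - y i) * layer i u -
    (y 0%N + \sum_(i < n) (y i.+1 - y i) * layer i v) = \sum_i c i.
  by rewrite opprD addrACA subrr add0r -sumrB; apply: eq_bigr => i _; rewrite /c; ring.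
have -> : w u - w v = \sum_i c i * r i ^+ 2.
  by rewrite -sumrB; apply: eq_bigr => i _; rewrite /c; ring.
rewrite mulrC; apply: weighted_cauchy_schwarz => i.
by rewrite mulr_ge0 ?subr_ge0 ?y_mono ?layer_homo.
Qed.

(* Thomson-type bound: the cuts between the ranks [a] and [b] act as resistors
   in series, each of resistance (potential drop) / (flux). *)
Lemma eff_conductance_le (a b : nat) : (a < b <= n)%N ->
  let rho := \sum_(a <= i < b) (y i.+1 - y i) / flux i in
  0 < rho ->
  eff_conductance [set v : G | (b <= rk v)%N]%SET [set v : G | (rk v <= a)%N]%SET
    <= rho^-1.
Proof.
move=> /andP[ab bn] rho rho_gt0.
(* [g] is 0 up to rank a, 1 from rank b on, and in between grows by the normalized resistance of
   each cut; [r] is its slope relative to [y]. *)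
pose g i := rho^-1 * \sum_(0 <= j < i | (a <= j < b)%N) (y j.+1 - y j) / flux j.
pose r i := if (a <= i < b)%N then rho^-1 / flux i else 0.
have gr i : (i < n)%N -> g i.+1 - g i = (y i.+1 - y i) * r i.
  move=> _; rewrite /g /r -mulrBr [X in _ * (X - _)]big_mkcond /=.
  rewrite big_nat_recr//= -big_mkcond /= addrAC subrr add0r.
  by case: ifP; rewrite ?mulr0// mulrCA.
have window N : (b <= N)%N -> forall h : nat -> R,
    \sum_(0 <= j < N | (a <= j < b)%N) h j = \sum_(a <= j < b) h j.
  move=> bN h; rewrite (big_nat_widen a b N)// (big_nat_widenl a 0%N)//.
  by apply: eq_bigl => j; rewrite /= andbC.
have disj : ([set v : G | (b <= rk v)%N] :&: [set v : G | (rk v <= a)%N])%SET = finset.set0.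
  apply/setP => v; rewrite !finset.inE; apply/negP => /andP[bv va].
  by have := leq_trans bv va; rewrite leqNgt ab.
have [_ C_le] := eff_conductanceP disj.
apply: le_trans (C_le _ _) _.
  exists [ffun v => g (rk v)]; split; last reflexivity.
  - by move=> v; rewrite finset.inE ffunE => bv; rewrite /g window// mulVf ?gt_eqF.
  - move=> v; rewrite finset.inE ffunE => va; rewrite /g big_nat_cond big1 ?mulr0//.
    move=> j /andP[/andP[_ jv] /andP[aj _]].
    by have := leq_trans jv (leq_trans va aj); rewrite ltnn.
apply: le_trans (energy_reparametrize_le gr) _.
rewrite -(big_mkord xpredT (fun i => (y i.+1 - y i) * r i ^+ 2 * flux i)).
rewrite [leLHS](_ : _ = \sum_(0 <= j < n | (a <= j < b)%N)
    rho^-1 ^+ 2 * ((y j.+1 - y j) / flux j)).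
  rewrite window// -mulr_sumr -/rho expr2 -mulrA mulVf ?mulr1//.
  by rewrite gt_eqF.
rewrite [RHS]big_mkcond /=; apply: eq_bigr => i _; rewrite /r; case: ifP => _.
  (* At zero flux the inverse is 0 by convention, and both sides vanish. *)
  have [->|F0] := eqVneq (flux i) 0; first by rewrite invr0 !mulr0.
  by field; rewrite F0 gt_eqF.
by rewrite expr0n /= mulr0 mul0r.
Qed.

End Layers.

(** * The upper bound *)

Lemma neumann_eigenvalue_le_content (R : realType) (G : wgraph R) :
  (1 < #|G|)%N -> neumann_eigenvalue G <= neumann_content G.
Proof.
move=> G_card.
have [_ lam_le] := neumann_eigenvalueP G_card.
have [[A [B [A0 B0 AB ->]]] _] := neumann_contentP G_card.
have [[x [xA xB CE]] _] := eff_conductanceP AB.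
rewrite /eff_resistance invrK CE.
have a_gt0 := mass_set_gt0 A0; have b_gt0 := mass_set_gt0 B0.
set a := mass_set A in a_gt0 *; set b := mass_set B in b_gt0 *.
pose m := \sum_v mass G v.
have m_gt0 : 0 < m.
  have/finset.set0Pn[v _] := A0.
  by rewrite /m (bigD1 v)//= ltr_pwDl ?mass_gt0// sumr_ge0// => u _; rewrite ltW ?mass_gt0.
pose c := (\sum_v mass G v * x v) / m.
pose z := [ffun v => x v - c].
have z1 : mass_form z [ffun=> 1] = 0.
  rewrite mass_form1; under eq_bigr do rewrite ffunE mulrBr.
  by rewrite sumrB -mulr_suml /c mulrCA divff ?gt_eqF// mulr1 subrr.
(* Vertices outside A and B are discarded; the centered potential is 1 - c on A and -c on B. *)
have zz : a * (1 - c) ^+ 2 + b * c ^+ 2 <= mass_form z z.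
  rewrite mass_formE /a /b /mass_set !mulr_suml.
  have -> : \sum_v mass G v * z v ^+ 2 = \sum_(v in A) mass G v * (1 - c) ^+ 2 +
      \sum_(v | v \notin A) mass G v * z v ^+ 2.
    rewrite (bigID (mem A))/=; congr (_ + _); apply: eq_bigr => v vA.
    by rewrite ffunE xA.
  rewrite lerD2l [leRHS](bigID (mem B))/=.
  rewrite [X in _ <= X + _](_ : _ = \sum_(v in B) mass G v * c ^+ 2).
    by rewrite lerDl; apply: sumr_ge0 => v _; rewrite mulr_ge0 ?sqr_ge0// ltW ?mass_gt0.
  apply: eq_big => [v|v /andP[_ vB]]; last by rewrite ffunE xB// sub0r sqrrN.
  apply: andb_idl => vB; apply/negP => vA.
  by have := finset.in_setI v A B; rewrite AB finset.inE vA vB.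
(* The left side of [zz] is smallest at c = a / (a + b); completing the square gives this
   minimum. *)
have ab : a * b / (a + b) <= mass_form z z.
  apply: le_trans zz; rewrite -subr_ge0.
  have -> : a * (1 - c) ^+ 2 + b * c ^+ 2 - a * b / (a + b) =
     ((a + b) * c - a) ^+ 2 / (a + b) by field; rewrite gt_eqF ?addr_gt0.
  by rewrite divr_ge0 ?sqr_ge0// ltW ?addr_gt0.
have ab_gt0 : 0 < a * b / (a + b) by rewrite divr_gt0 ?mulr_gt0 ?addr_gt0.
have z0 : z != 0.
  apply/eqP => z0; have := lt_le_trans ab_gt0 ab.
  by rewrite mass_formE big1 ?ltxx// => v _; rewrite z0 ffunE expr0n mulr0.
apply: le_trans (lam_le _ _) _; first by exists z.
rewrite energy_shift [leRHS]mulrC ler_wpM2l ?energy_ge0//.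
have -> : a^-1 + b^-1 = (a * b / (a + b))^-1.
  by field; rewrite !gt_eqF ?addr_gt0.
by rewrite lef_pV2// posrE ?(lt_le_trans ab_gt0 ab).
Qed.

(** * The lower bound *)

(** Ranking the vertices by [x] gives a weighted path, and [path_poincare] applies to it with the
    series resistance scaled by [Psi] as coordinate. *)
Lemma neumann_content_mass_form_le (R : realType) (G : wgraph R)
    (x : {ffun G -> R}) : connected_graph G -> (1 < #|G|)%N ->
  x != 0 -> mass_form x [ffun=> 1] = 0 ->
  neumann_content G * mass_form x x <= 4 * energy x.
Proof.
move=> G_conn G_card x0 x1.
have [_ Psi_le] := neumann_contentP G_card.
set Psi := neumann_content G in Psi_le *.
(* The case split stands in for a proof that [Psi] is positive; below, [Psi] serves as a divisor. *)
have [Psi_le0|Psi_gt0] := leP Psi 0.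
  apply: (@le_trans _ _ 0); last by rewrite mulr_ge0 ?energy_ge0.
  by rewrite mulr_le0_ge0// ltW// mass_form_gt0.
have [e [rk [rkG rkK eK x_homo]]] := sorted_enumeration x (ltnW G_card).
have [n nE] : exists n, #|G| = n.+1 by exists #|G|.-1; lia.
pose y i := x (e i).
have y_rk v : y (rk v) = x v by rewrite /y rkK.
have rk_le v : (rk v <= n)%N by rewrite -ltnS -nE rkG.
have eKn i : (i <= n)%N -> rk (e i) = i by rewrite -ltnS -nE; exact: eK.
have y_mono i : (i < n)%N -> y i <= y i.+1.
  by move=> lin; apply: x_homo; rewrite !eKn// ltnW.
pose F := flux rk x.
have F_ge0 i : 0 <= F i by exact: flux_ge0 y_rk rk_le y_mono i.
(* Some edge crosses the cut after rank i; its end values straddle the gap, so its term is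
   positive. *)
have F_gt0 i : (i < n)%N -> y i < y i.+1 -> 0 < F i.
  move=> lin lty.
  have [||u [v [uv ui vi]]] := @connect_cut_edge _ (adj G) (fun v => (rk v <= i)%N)
    (e i) (e i.+1) (G_conn _ _).
  - by rewrite eKn// ltnW.
  - by rewrite eKn// ltnn.
  rewrite -ltnNge in vi.
  apply: energy_form_gt0 uv _.
    exact: flux_term_ge0 y_rk rk_le y_mono i.
  rewrite /layer vi ltnNge ui /= sub0r mulrN1 opprB subr_gt0.
  rewrite -(y_rk u) -(y_rk v).
  apply: (@le_lt_trans _ _ (y i)).
    by apply: (y_homo y_mono); rewrite ui ltnW.
  by apply: lt_le_trans lty _; apply: (y_homo y_mono); rewrite vi rk_le.
pose P i := Psi * \sum_(0 <= j < i) (y j.+1 - y j) / F j.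
have PS i : P i.+1 - P i = Psi * ((y i.+1 - y i) / F i).
  by rewrite /P big_nat_recr//= mulrDr addrAC subrr add0r.
have rho_ge0 i : (i < n)%N -> 0 <= (y i.+1 - y i) / F i.
  by move=> lin; rewrite divr_ge0// subr_ge0 y_mono.
have P_gt0 : P 0%N < P n.
  rewrite /P big_geq// mulr0 mulr_gt0// big_mkord.
  (* Without a strict increase [x] is constant, and mean zero then makes it 0. *)
  have [i yi|y_const] := pickP (fun i : 'I_n => y i < y i.+1).
    rewrite (bigD1 i)//= ltr_pwDl ?divr_gt0 ?subr_gt0 ?F_gt0//.
    by apply: sumr_ge0 => j _; exact: rho_ge0.
  have xE v : x v = y 0%N.
    rewrite -y_rk (rank_function_layers rk_le) big1 ?addr0// => i _.
    suff -> : y i.+1 - y i = 0 by rewrite mul0r.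
    by apply/eqP; rewrite subr_eq0 eq_le y_mono// andbT leNgt y_const.
  have m_gt0 : 0 < \sum_v mass G v.
    rewrite (bigD1 (e 0%N))//= ltr_pwDl ?mass_gt0//.
    by apply: sumr_ge0 => v _; rewrite ltW ?mass_gt0.
  case/eqP: x0; apply/ffunP => v; rewrite xE ffunE; apply/eqP.
  move/eqP: x1; rewrite mass_form1; under eq_bigr do rewrite xE.
  by rewrite -mulr_suml mulf_eq0 gt_eqF.
(* The slope of [y] in the coordinate [P] is [F i / Psi], since [P] carries a factor [Psi]. *)
have [i _|i _|i lin|i lin|a b /andP[ab bn]|c c_le] := @path_poincare R n
   (fun i => mass G (e i)) y P (fun i => F i / Psi) _ _ _ P_gt0 _ _.
- exact: mass_gt0.
- by rewrite divr_ge0// ltW.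
- by rewrite -subr_ge0 PS mulr_ge0 ?rho_ge0// ltW.
- rewrite PS; have := y_mono i lin; rewrite le_eqVlt => /orP[/eqP->|lty].
    by rewrite subrr mul0r !mulr0.
  by field; rewrite !gt_eqF ?F_gt0.
- set U := \sum_(b <= i < n.+1) _; set L := \sum_(0 <= i < a.+1) _.
  pose A := [set v : G | (b <= rk v)%N]%SET.
  pose B := [set v : G | (rk v <= a)%N]%SET.
  have A0 : A != finset.set0.
    by apply/finset.set0Pn; exists (e b); rewrite finset.inE eKn.
  have an : (a <= n)%N by rewrite (leq_trans (ltnW ab)).
  have B0 : B != finset.set0.
    by apply/finset.set0Pn; exists (e a); rewrite finset.inE eKn.
  have disj : (A :&: B)%SET = finset.set0.
    apply/setP => v; rewrite !finset.inE; apply/negP => /andP[bv va].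
    by have := leq_trans bv va; rewrite leqNgt ab.
  have UE : mass_set A = U.
    rewrite /mass_set /U (big_nat_widenl b 0%N)// -nE.
    rewrite -(sum_enumeration (fun i => b <= i)%N _ rkG rkK eK).
    by apply: eq_bigl => v; rewrite finset.inE.
  have LE : mass_set B = L.
    rewrite /mass_set /L (big_nat_widen 0%N a.+1 n.+1)// -nE.
    rewrite -(sum_enumeration (fun i => i < a.+1)%N _ rkG rkK eK).
    by apply: eq_bigl => v; rewrite finset.inE ltnS.
  have UL_ge0 : 0 <= U^-1 + L^-1.
    by rewrite -UE -LE addr_ge0// invr_ge0 ltW// mass_set_gt0.
  pose rho := \sum_(a <= i < b) (y i.+1 - y i) / F i.
  have -> : P b - P a = Psi * rho.
    by rewrite /P -mulrBr (big_cat_nat (n := a))//= ?(ltnW ab)// addrAC subrr add0r.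
  have [rho_le0|rho_gt0] := leP rho 0.
    by apply: le_trans UL_ge0; rewrite pmulr_rle0.
  have abn : (a < b <= n)%N by rewrite ab.
  have C_le := eff_conductance_le y_rk rk_le y_mono abn rho_gt0.
  (* [Psi] is at most 1/U + 1/L times the conductance between A and B, which is at most 1 / rho. *)
  rewrite -ler_pdivlMr//; apply: (@le_trans _ _ ((U^-1 + L^-1) * eff_conductance A B)).
    apply: Psi_le; exists A, B; split=> //.
    by rewrite /eff_resistance invrK UE LE.
  exact: ler_wpM2l.
(* The second moment is least about the mean, which is 0. *)
have var_le : mass_form x x <= \sum_v mass G v * (x v - c) ^+ 2.
  have -> : \sum_v mass G v * (x v - c) ^+ 2 =
      mass_form x x - 2 * c * mass_form x [ffun=> 1] + c ^+ 2 * \sum_v mass G v.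
    rewrite mass_formE mass_form1 !mulr_sumr -sumrN -!big_split /=.
    by apply: eq_bigr => v _; ring.
  rewrite x1 mulr0 subr0 lerDl mulr_ge0 ?sqr_ge0//.
  by apply: sumr_ge0 => v _; rewrite ltW ?mass_gt0.
rewrite mulrC -ler_pdivlMr//; apply: le_trans var_le _.
rewrite (sum_enumeration xpredT _ rkG rkK eK) nE; apply: le_trans c_le _.
rewrite -mulrA ler_pM2l// (energy_flux y_rk rk_le) mulr_suml big_mkord.
by apply: ler_sum => i _; rewrite mulrAC.
Qed.

Theorem theorem7 (R : realType) (G : wgraph R)
  (G_connected : connected_graph G) (G_card : (2 <= #|G|)%N) :
  neumann_content G / 4 <= neumann_eigenvalue G /\
  neumann_eigenvalue G <= neumann_content G.
Proof.
split; last exact: neumann_eigenvalue_le_content.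
have [[x [x1 x0 ->]] _] := neumann_eigenvalueP G_card.
rewrite ler_pdivlMr ?mass_form_gt0// mulrAC ler_pdivrMr// [leRHS]mulrC.
exact: neumann_content_mass_form_le.
Qed.
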